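(* Let $d\ge 3$, let $T_d$ be the $d$-regular tree with a fixed legal labelling $l$, and let $F\le S_d$. Then the following statements hold. (i) $\mathrm{U}(F)$ is closed in $\mathrm{Aut}(T_d)$. (ii) $\mathrm{U}(F)$ is locally permutation isomorphic to $F$. (iii) $\mathrm{U}(F)$ is vertex-transitive. (iv) $\mathrm{U}(F)$ is edge-transitive if and only if the action of $F$ on $\{1,\ldots,d\}$ is transitive. (v) $\mathrm{U}(F)$ is discrete in $\mathrm{Aut}(T_d)$ if and only if the action of $F$ on $\{1,\ldots,d\}$ is free.
   Context: Write $V$ and $E$ for the sets of vertices and of directed edges of $T_d$; for $e=(x,y)\in E$ put $o(e)=x$, $\bar e=(y,x)$, and call $\{e,\bar e\}$ a geometric edge. For $x\in V$, $E(x)=\{e\in E\mid o(e)=x\}$. A legal labelling is a map $l:E\to\{1,\ldots,d\}$ with $l(e)=l(\bar e)$ for all $e\in E$ such that for every $x\in V$ the restriction $l_x:=l|_{E(x)}:E(x)\to\{1,\ldots,d\}$ is a bijection. For $g\in\mathrm{Aut}(T_d)$ and $x\in V$ let $c(g,x):=l_{gx}\circ g\circ l_x^{-1}\in S_d$. The universal group is $\mathrm{U}(F)=\mathrm{U}^{(l)}(F):=\{g\in\mathrm{Aut}(T_d)\mid c(g,x)\in F\text{ for all }x\in V\}$. A subgroup $H\le\mathrm{Aut}(T_d)$ is locally permutation isomorphic to $F$ if for every vertex $x$ the permutation group induced on $E(x)$ by the stabilizer of $x$ in $H$ is permutation isomorphic to $F$ acting on $\{1,\ldots,d\}$. Edge-transitive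 means transitive on geometric edges. An action is free if no non-trivial element fixes a point. $\mathrm{Aut}(T_d)$ has the topology of pointwise convergence on vertices. *)

(* Defs.v *)
From HB Require Import structures.
From mathcomp Require Import all_boot all_fingroup.
From mathcomp Require Import boolp classical_sets functions cardinality.
From mathcomp Require Import topology.

Set Implicit Arguments.
Unset Strict Implicit.
Unset Printing Implicit Defensive.

Local Open Scope classical_set_scope.

(* The vertex set carries a [choiceType] structure only because the path
   library and [discrete_topology] ask for it; classically every type has one.
   In [tree_acyclic] the bound excludes the degenerate closed paths: [[::]] and
   a single edge traversed back and forth. *)
Record regular_tree (d : nat) := RegularTree {
  vertex :> choiceType;
  adj : rel vertex;
  adj_sym : symmetric adj;
  adj_irrefl : irreflexive adj;
  tree_nonempty : inhabited vertex;
  tree_connected : forall x y, exists2 p : seq vertex,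
    path adj x p & last x p = y;
  tree_acyclic : forall c : seq vertex,
    path.cycle adj c -> uniq c -> size c <= 2;
  tree_regular : forall x, ([set y | adj x y] #= `I_d)%card
}.
Arguments adj {d} T _ _ : rename.

Definition edge d (T : regular_tree d) := {e : T * T | adj T e.1 e.2}.

Definition org d (T : regular_tree d) (e : edge T) : T := (val e).1.

Lemma edge_rev_subproof d (T : regular_tree d) (e : edge T) :
  adj T (val e).2 (val e).1.
Proof. by rewrite adj_sym; exact: (valP e). Qed.

Definition edge_rev d (T : regular_tree d) (e : edge T) : edge T :=
  exist (fun e : T * T => adj T e.1 e.2) ((val e).2, (val e).1)
    (edge_rev_subproof e).

Definition geom_edge d (T : regular_tree d) (e : edge T) : set (edge T) :=
  [set e; edge_rev e].

(* E(x), as a type. *)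
Definition star d (T : regular_tree d) (x : T) := {e : edge T | org e == x}.

Record tree_aut d (T : regular_tree d) := Aut {
  aut_fun :> T -> T;
  aut_bij : bijective aut_fun;
  aut_adj : forall x y, adj T (aut_fun x) (aut_fun y) = adj T x y
}.

Lemma aut_ext d (T : regular_tree d) (g h : tree_aut T) : g =1 h -> g = h.
Proof.
case: g h => [f bf af] [f' bf' af'] /= /funext ff'; subst f'.
by rewrite (Prop_irrelevance bf bf') (Prop_irrelevance af af').
Qed.

HB.instance Definition _ d (T : regular_tree d) := gen_eqMixin (tree_aut T).
HB.instance Definition _ d (T : regular_tree d) := gen_choiceMixin (tree_aut T).

Definition aut_one d (T : regular_tree d) : tree_aut T :=
  @Aut d T id (inv_bij (fun _ => erefl)) (fun _ _ => erefl).

Lemma aut_mul_adj d (T : regular_tree d) (g h : tree_aut T) x y :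
  adj T (g (h x)) (g (h y)) = adj T x y.
Proof. by rewrite !aut_adj. Qed.

(* [g * h] is [g] after [h]: automorphisms act from the left. *)
Definition aut_mul d (T : regular_tree d) (g h : tree_aut T) : tree_aut T :=
  @Aut d T (g \o h) (bij_comp (aut_bij g) (aut_bij h)) (aut_mul_adj g h).

Lemma bijective_inv A B (f : A -> B) :
  bijective f -> exists f', cancel f f' /\ cancel f' f.
Proof. by case=> f' ff' f'f; exists f'. Qed.

Definition bij_inv A B (f : A -> B) (bf : bijective f) : B -> A :=
  sval (cid (bijective_inv bf)).

Lemma bij_invK A B (f : A -> B) (bf : bijective f) : cancel f (bij_inv bf).
Proof. exact: (svalP (cid (bijective_inv bf))).1. Qed.

Lemma bij_invKV A B (f : A -> B) (bf : bijective f) : cancel (bij_inv bf) f.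
Proof. exact: (svalP (cid (bijective_inv bf))).2. Qed.

Lemma aut_inv_adj d (T : regular_tree d) (g : tree_aut T) x y :
  adj T (bij_inv (aut_bij g) x) (bij_inv (aut_bij g) y) = adj T x y.
Proof. by rewrite -(aut_adj g) !bij_invKV. Qed.

Definition aut_inv d (T : regular_tree d) (g : tree_aut T) : tree_aut T :=
  @Aut d T (bij_inv (aut_bij g))
    (Bijective (bij_invKV (aut_bij g)) (bij_invK (aut_bij g))) (aut_inv_adj g).

Lemma aut_mulA d (T : regular_tree d) : associative (@aut_mul d T).
Proof. by move=> f g h; exact: aut_ext. Qed.
Lemma aut_mul1g d (T : regular_tree d) :
  left_id (aut_one T) (@aut_mul d T).
Proof. by move=> g; exact: aut_ext. Qed.
Lemma aut_mulg1 d (T : regular_tree d) :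
  right_id (aut_one T) (@aut_mul d T).
Proof. by move=> g; exact: aut_ext. Qed.
Lemma aut_mulVg d (T : regular_tree d) :
  left_inverse (aut_one T) (@aut_inv d T) (@aut_mul d T).
Proof. by move=> g; apply: aut_ext => x /=; exact: bij_invK. Qed.
Lemma aut_mulgV d (T : regular_tree d) :
  right_inverse (aut_one T) (@aut_inv d T) (@aut_mul d T).
Proof. by move=> g; apply: aut_ext => x /=; exact: bij_invKV. Qed.

HB.instance Definition _ d (T : regular_tree d) :=
  isGroup.Build (tree_aut T) (@aut_mulA d T) (@aut_mul1g d T) (@aut_mulg1 d T)
    (@aut_mulVg d T) (@aut_mulgV d T).

HB.instance Definition _ d (T : regular_tree d) :=
  Topological.copy (tree_aut T)
    (initial_topology
       (@aut_fun d T : tree_aut T -> {ptws T -> discrete_topology T})).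

Lemma aut_edge_subproof d (T : regular_tree d) (g : tree_aut T) (e : edge T) :
  adj T (g (val e).1) (g (val e).2).
Proof. by rewrite aut_adj; exact: (valP e). Qed.

Definition aut_edge d (T : regular_tree d) (g : tree_aut T) (e : edge T) : edge T :=
  exist (fun e : T * T => adj T e.1 e.2) (g (val e).1, g (val e).2)
    (aut_edge_subproof g e).

Lemma aut_star_subproof d (T : regular_tree d) (g : tree_aut T) (x : T)
  (e : star x) : org (aut_edge g (val e)) == g x.
Proof. by apply/eqP; exact: (congr1 g (eqP (valP e))). Qed.

Definition aut_star d (T : regular_tree d) (g : tree_aut T) (x : T) (e : star x) :
    star (g x) :=
  exist (fun e : edge T => org e == g x) (aut_edge g (val e))
    (aut_star_subproof g e).

(* The label set {1, ..., d} is rendered as ['I_d]. *)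
Record legal_labelling d (T : regular_tree d) := LegalLabelling {
  label :> edge T -> 'I_d;
  label_rev : forall e, label (edge_rev e) = label e;
  label_bij : forall x : T, bijective (fun e : star x => label (val e))
}.

Definition local_label d (T : regular_tree d) (l : legal_labelling T) (x : T) :
  star x -> 'I_d := fun e => l (val e).

Definition local_label_inv d (T : regular_tree d) (l : legal_labelling T)
  (x : T) : 'I_d -> star x := bij_inv (label_bij l x).

Definition local_action_fun d (T : regular_tree d) (l : legal_labelling T)
    (g : tree_aut T) (x : T) : 'I_d -> 'I_d :=
  @local_label d T l (g x) \o @aut_star d T g x \o local_label_inv l x.

Lemma aut_edge_inj d (T : regular_tree d) (g : tree_aut T) :
  injective (aut_edge g).
Proof.
move=> e f /(congr1 val) /= [/(bij_inj (aut_bij g)) e1 /(bij_inj (aut_bij g)) e2].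
by apply: val_inj; rewrite [LHS]surjective_pairing e1 e2 -surjective_pairing.
Qed.

Lemma local_action_inj d (T : regular_tree d) (l : legal_labelling T)
  (g : tree_aut T) (x : T) : injective (local_action_fun l g x).
Proof.
apply: inj_comp; last exact: can_inj (bij_invKV (label_bij l x)).
apply: inj_comp; first exact: bij_inj (label_bij l (g x)).
by move=> e f /(congr1 val) /= /aut_edge_inj /val_inj.
Qed.

(* c(g, x) *)
Definition local_action d (T : regular_tree d) (l : legal_labelling T)
  (g : tree_aut T) (x : T) : 'S_d := perm (@local_action_inj d T l g x).

Definition universal_group d (T : regular_tree d) (l : legal_labelling T)
    (F : {group 'S_d}) : {pred tree_aut T} :=
  fun g => `[< forall x : T, local_action l g x \in F >].

Lemma local_actionE d (T : regular_tree d) (l : legal_labelling T)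
  (g : tree_aut T) (e : edge T) : local_action l g (org e) (l e) = l (aut_edge g e).
Proof.
rewrite permE /local_action_fun /= /local_label /=.
pose e' : star (org e) := exist (fun f => org f == org e) e (eqxx _).
by rewrite -[l e]/(l (val e')) /local_label_inv (bij_invK (label_bij l (org e))).
Qed.

Lemma local_action_eqP d (T : regular_tree d) (l : legal_labelling T)
  (g : tree_aut T) (x : T) (s : 'S_d) :
  (forall e : edge T, org e = x -> s (l e) = l (aut_edge g e)) ->
  local_action l g x = s.
Proof.
move=> sP; apply/permP => i.
have [e [ox <-]] : exists e : edge T, org e = x /\ l e = i.
  exists (val (local_label_inv l x i)); split; last exact: (bij_invKV (label_bij l x)).
  exact: eqP (valP (local_label_inv l x i)).
by rewrite (sP _ ox) -ox local_actionE.
Qed.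

(* mathcomp permutations compose from left to right, hence the order. *)
Lemma local_actionM d (T : regular_tree d) (l : legal_labelling T)
  (g h : tree_aut T) (x : T) :
  local_action l (g * h)%g x
  = (local_action l h x * local_action l g (h x))%g.
Proof.
apply: local_action_eqP => e <-; rewrite permM local_actionE.
by rewrite -[h _]/(org (aut_edge h e)) local_actionE; congr (l _); apply: val_inj.
Qed.

Lemma local_action1 d (T : regular_tree d) (l : legal_labelling T) (x : T) :
  local_action l 1%g x = 1%g.
Proof.
apply: local_action_eqP => e _; rewrite perm1; congr (l _).
by apply: val_inj => /=; case: (val e).
Qed.

Lemma universal_groupM d (T : regular_tree d) (l : legal_labelling T)
  (F : {group 'S_d}) : mulg_closed (universal_group l F).
Proof.
move=> g h /asboolP gF /asboolP hF; apply/asboolP => x.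
by rewrite local_actionM groupM.
Qed.

Lemma universal_group1 d (T : regular_tree d) (l : legal_labelling T)
  (F : {group 'S_d}) : (1%g : tree_aut T) \in universal_group l F.
Proof. by apply/asboolP => x; rewrite local_action1 group1. Qed.

Lemma universal_groupV d (T : regular_tree d) (l : legal_labelling T)
  (F : {group 'S_d}) : invg_closed (universal_group l F).
Proof.
move=> g /asboolP gF; apply/asboolP => x.
have ab := local_actionM l g g^-1%g x; rewrite mulgV local_action1 in ab.
suff -> : local_action l g^-1%g x = (local_action l g (g^-1%g x))^-1%g.
  by rewrite groupV.
by apply: (mulIg (local_action l g (g^-1%g x))); rewrite mulVg -ab.
Qed.

HB.instance Definition _ d (T : regular_tree d) (l : legal_labelling T)
  (F : {group 'S_d}) :=
  isMulClosed.Build (tree_aut T) (universal_group l F) (@universal_groupM d T l F).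
HB.instance Definition _ d (T : regular_tree d) (l : legal_labelling T)
  (F : {group 'S_d}) :=
  isMul1Closed.Build (tree_aut T) (universal_group l F) (@universal_group1 d T l F).
HB.instance Definition _ d (T : regular_tree d) (l : legal_labelling T)
  (F : {group 'S_d}) :=
  isInvClosed.Build (tree_aut T) (universal_group l F) (@universal_groupV d T l F).

(* A bijection [phi] of the underlying sets together with a compatible group
   isomorphism [theta] from [P] onto [Q]. *)
Definition perm_isomorphic (X Y : Type) (P : set (X -> X)) (Q : set (Y -> Y)) :=
  exists (phi : X -> Y) (theta : (X -> X) -> (Y -> Y)),
    [/\ bijective phi, set_bij P Q theta,
        forall p q, P p -> P q -> theta (p \o q) = theta p \o theta q &
        forall p, P p -> forall x, phi (p x) = theta p (phi x)].

Definition perm_group_fun d (F : {group 'S_d}) : set ('I_d -> 'I_d) :=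
  [set (s : 'I_d -> 'I_d) | s in [set` F]].

(* The permutations of E(x) induced by the stabilizer of [x] in [H]. *)
Definition stab_on_star d (T : regular_tree d) (H : groupClosed (tree_aut T))
    (x : T) : set (star x -> star x) :=
  [set p | exists g : tree_aut T,
    [/\ g \in H, g x = x & forall e, val (p e) = aut_edge g (val e)]].

Arguments stab_on_star {d T} H x _.

Definition locally_perm_isomorphic d (T : regular_tree d)
    (H : groupClosed (tree_aut T)) (F : {group 'S_d}) :=
  forall x : T, perm_isomorphic (stab_on_star H x) (perm_group_fun F).

Definition vertex_transitive d (T : regular_tree d) (H : groupClosed (tree_aut T)) :=
  forall x y : T, exists2 g : tree_aut T, g \in H & g x = y.

Definition edge_transitive d (T : regular_tree d) (H : groupClosed (tree_aut T)) :=
  forall e f : edge T, exists2 g : tree_aut T,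
    g \in H & aut_edge g @` geom_edge e = geom_edge f.

Definition free_action d (F : {group 'S_d}) :=
  forall s : 'S_d, s \in F -> s != 1%g -> forall i : 'I_d, s i != i.

(* The subspace topology on [A] is the discrete one. *)
Definition discrete_subset (X : topologicalType) (A : set X) :=
  forall B : set (set_type A), open B.

(* Main.v *)
Require Import Defs.
From mathcomp Require Import all_boot all_fingroup.
From mathcomp Require Import boolp classical_sets functions cardinality.
From mathcomp Require Import topology.

(** The labelling turns the tree into a Cayley-like graph: every label names
    exactly one neighbour of each vertex, and following the same label twice
    leads back.  Vertices are thus reached from a base point by words in the
    labels, and since the tree has no cycles, by exactly one word without
    repeated consecutive letters ([reduced_ex], [reduced_inj]).

    An automorphism [g] is determined by the image of one vertex together with
    its local actions, since [g] maps the neighbour of [v] along [i] to the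
    neighbour of [g v] along [local_action l g v i].  Conversely
    ([aut_of_local_action]), a family of permutations [sigma v] is the family
    of local actions of some automorphism, with a prescribed value at one
    vertex, as soon as the permutations at the two ends of each edge agree on
    the label of that edge: one translates words letter by letter through
    [sigma], and cancelling a repeated letter in a word cancels a repeated
    letter in its translation, so that the end point of the translated word
    only depends on the end point of the original one.

    All the existence statements are instances of this extension principle.
    A constant family with value in [F] is compatible and lands in the
    universal group; it yields vertex-transitivity, the surjectivity of the
    local action onto [F], and edge-transitivity for transitive [F].  When a
    nontrivial [s] in [F] fixes [i], the family equal to [s] beyond the edges
    labelled [i] at distance [n] from a base point, and to the identity
    elsewhere, gives a nontrivial element that fixes a ball of radius [n]; such
    elements converge to the identity, so the universal group is not discrete.

    The local action at [v] only depends on the values at [v] and its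
    neighbours, hence is locally constant in [g]: this gives closedness.
    Finally, when [F] acts freely, an element of the universal group that fixes
    an edge has trivial local action at its end points, thus fixes their
    neighbours, and so on: it is the identity.  Therefore the conditions
    [h x = g x] and [h y = g y], for adjacent [x] and [y], isolate [g]
    in the universal group. *)

Set Implicit Arguments.
Unset Strict Implicit.
Unset Printing Implicit Defensive.

(** * Neighbours named by labels *)

Section Words.
Context {d : nat} {T : regular_tree d} (l : legal_labelling T).
Implicit Types (v u x y : T) (i j : 'I_d) (w r : seq 'I_d).

Definition edge_at v i : edge T := val (local_label_inv l v i).

Definition nbr v i : T := (val (edge_at v i)).2.

Lemma org_edge_at v i : org (edge_at v i) = v.
Proof. exact: eqP (valP (local_label_inv l v i)). Qed.

Lemma label_edge_at v i : l (edge_at v i) = i.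
Proof. exact: (bij_invKV (label_bij l v)). Qed.

Lemma edge_atE (e : edge T) : edge_at (org e) (l e) = e.
Proof.
pose e' : star (org e) := exist (fun f => org f == org e) e (eqxx _).
rewrite /edge_at /local_label_inv -[l e]/(l (val e')).
by rewrite (bij_invK (label_bij l _)).
Qed.

Lemma val_edge_at v i : val (edge_at v i) = (v, nbr v i).
Proof. by rewrite [LHS]surjective_pairing -/(org _) org_edge_at. Qed.

Lemma adj_nbr v i : adj T v (nbr v i).
Proof. by have := valP (edge_at v i); rewrite val_edge_at. Qed.

Lemma adj_ex_nbr v u : adj T v u -> exists i, u = nbr v i.
Proof.
move=> vu; pose e : edge T := exist (fun e : T * T => adj T e.1 e.2) (v, u) vu.
by exists (l e); rewrite /nbr -[v]/(org e) edge_atE.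
Qed.

Lemma nbr_inj v : injective (nbr v).
Proof.
move=> i j ij; rewrite -(label_edge_at v i) -(label_edge_at v j).
by congr (l _); apply: val_inj; rewrite !val_edge_at ij.
Qed.

Lemma edge_rev_at v i : edge_rev (edge_at v i) = edge_at (nbr v i) i.
Proof.
have o : org (edge_rev (edge_at v i)) = nbr v i by [].
by rewrite -[LHS]edge_atE o label_rev label_edge_at.
Qed.

(** The two orientations of an edge carry the same label, so the way back has
    the label of the way out. *)
Lemma nbrK i : involutive (nbr^~ i).
Proof. by move=> v; rewrite {1}/nbr -edge_rev_at /= -/(org _) org_edge_at. Qed.

Lemma aut_edge_at (g : tree_aut T) v i :
  aut_edge g (edge_at v i) = edge_at (g v) (local_action l g v i).
Proof.
have := local_actionE l g (edge_at v i).
rewrite org_edge_at label_edge_at => ->.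
have o : org (aut_edge g (edge_at v i)) = g v := congr1 g (org_edge_at v i).
by rewrite -{1}[aut_edge g _]edge_atE o.
Qed.

Lemma aut_nbr (g : tree_aut T) v i :
  g (nbr v i) = nbr (g v) (local_action l g v i).
Proof. by rewrite [RHS]/nbr -aut_edge_at. Qed.

Lemma local_action_nbr (g : tree_aut T) v (s : 'S_d) :
  (forall i, g (nbr v i) = nbr (g v) (s i)) -> local_action l g v = s.
Proof.
by move=> gs; apply/permP => i; apply/(@nbr_inj (g v)); rewrite -aut_nbr gs.
Qed.

(** * Words and walks *)

Definition walk : T -> seq 'I_d -> T := foldl nbr.

Lemma walk_cat v w r : walk v (w ++ r) = walk (walk v w) r.
Proof. exact: foldl_cat. Qed.

Lemma walk_rcons v w i : walk v (rcons w i) = nbr (walk v w) i.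
Proof. by rewrite -cats1 walk_cat. Qed.

Lemma walk_rev v w : walk (walk v w) (rev w) = v.
Proof.
elim: w v => //= i w IHw v.
by rewrite rev_cons walk_rcons IHw nbrK.
Qed.

Lemma walk_ex v u : exists w, walk v w = u.
Proof.
have [p] := tree_connected v u.
elim: p v => [|z p IHp] v /=; first by move=> _ <-; exists [::].
case/andP=> /adj_ex_nbr[i ->] zp /(IHp _ zp)[w wu].
by exists (i :: w).
Qed.

Definition reduced w := sorted (fun i j => i != j) w.

Lemma reduced_cons i w : reduced w -> reduced (i :: w) \/ exists r, w = i :: r.
Proof.
case: w => [|j w]; first by left.
have [->|ij] := eqVneq i j; first by right; exists w.
by move=> jw; left; rewrite /reduced /= ij.
Qed.

Lemma reduced_rev w : reduced (rev w) = reduced w.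
Proof.
rewrite /reduced rev_sorted; apply: eq_sorted => i j; by rewrite eq_sym.
Qed.

Lemma path_scanl v w : path (adj T) v (scanl nbr v w).
Proof. by elim: w v => //= i w IHw v; rewrite adj_nbr IHw. Qed.

(** This is where the absence of cycles is used.  If the vertices visited by a
    closed walk are distinct, they form a cycle, which has length at most two,
    and a closed walk of length two uses the same label twice.  Otherwise a
    shorter closed walk sits inside the given one. *)
Lemma closed_reduced_nil v w : reduced w -> walk v w = v -> w = [::].
Proof.
have [n] := ubnP (size w); elim: n v w => // n IHn v w /ltnSE.
case/lastP: w => // w i; rewrite size_rcons => wn red wv.
have [cu|/(uniqPn v)[a [b [ab]]]] := boolP (uniq (v :: scanl nbr v w)).
  have cc : path.cycle (adj T) (v :: scanl nbr v w).
    have := path_scanl v (rcons w i).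
    by rewrite scanl_rcons -/(walk _ _) wv.
  have := tree_acyclic cc cu; rewrite /= size_scanl !ltnS.
  case: w wv red {wn cc cu} => [|j [|//]] /=.
    by move=> vv; have := adj_nbr v i; rewrite vv adj_irrefl.
  by rewrite -{2}(nbrK j v) => /nbr_inj->; rewrite eqxx.
rewrite /= size_scanl ltnS => bw.
have aw : a <= size w by exact: leq_trans (ltnW ab) bw.
rewrite !nth_cons_scanl // -!/(walk _ _) => vab.
have eb : take b w = take a w ++ drop a (take b w).
  by rewrite -{1}(cat_take_drop a (take b w)) take_takel // ltnW.
have sm : size (drop a (take b w)) = b - a by rewrite size_drop size_takel.
(* The part of the word between the two visits of the same vertex is closed. *)
suff m0 : drop a (take b w) = [::].
  by move: sm; rewrite m0 /= => /esym/eqP; rewrite subn_eq0 leqNgt ab.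
apply: (IHn (walk v (take a w))); last by rewrite -walk_cat -eb.
  by rewrite sm; apply: leq_trans wn; rewrite ltnS (leq_trans (leq_subr _ _)).
apply: suffix_sorted (suffix_drop _ _) _.
apply: prefix_sorted (prefix_take _ _) _.
exact: prefix_sorted (prefix_rcons _ _) red.
Qed.

(** If the first letters differ, the walk along the reverse of one word followed
    by the other one is closed and still reduced at the junction. *)
Lemma reduced_inj v w r : reduced w -> reduced r -> walk v w = walk v r -> w = r.
Proof.
elim: w v r => [|i w IHw] v [|j r] redw redr wr.
- by [].
- by rewrite [RHS](closed_reduced_nil redr (esym wr)).
- by rewrite [LHS](closed_reduced_nil redw wr).
have [eij|ij] := eqVneq i j.
  rewrite eij in wr *.
  by rewrite (IHw _ _ (path_sorted redw) (path_sorted redr) wr).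
suff : rev (i :: w) ++ j :: r = [::] by case: (rev _).
apply: (@closed_reduced_nil (walk v (i :: w))).
  rewrite rev_cons cat_rcons /reduced sorted_cat_cons /= ij.
  by rewrite -rev_cons -/(reduced _) reduced_rev redw.
by rewrite walk_cat walk_rev.
Qed.

(** * Automorphisms with prescribed local actions *)

(** A condition that every family of local actions satisfies: the image of an
    edge has the same label in both orientations. *)
Definition compatible (sigma : T -> 'S_d) :=
  forall v i, sigma (nbr v i) i = sigma v i.

(** The word read along the image of the walk from [v] along [w] under an
    automorphism with local actions [sigma]. *)
Fixpoint relabel (sigma : T -> 'S_d) v w : seq 'I_d :=
  if w is i :: w' then sigma v i :: relabel sigma (nbr v i) w' else [::].

Lemma relabel_cat sigma v w r :
  relabel sigma v (w ++ r) = relabel sigma v w ++ relabel sigma (walk v w) r.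
Proof. by elim: w v => //= i w IHw v; rewrite IHw. Qed.

Lemma relabel1 v w : relabel (fun=> 1%g) v w = w.
Proof. by elim: w v => //= i w IHw v; rewrite perm1 IHw. Qed.

Lemma compatible1 : compatible (fun=> 1%g). Proof. by []. Qed.

Section Relabel.
Context (sigma : T -> 'S_d) (cs : compatible sigma).

Lemma relabel_rev v w :
  relabel sigma (walk v w) (rev w) = rev (relabel sigma v w).
Proof.
elim: w v => //= i w IHw v.
by rewrite !rev_cons -!cats1 relabel_cat IHw /= walk_rev cs.
Qed.

(** By compatibility, two consecutive letters are both read through the
    permutation at the vertex that separates them. *)
Lemma reduced_relabel v w : reduced w -> reduced (relabel sigma v w).
Proof.
elim: w v => // i [|j w] //= IHw v /andP[ij jw].
by apply/andP; split; [rewrite -cs (inj_eq perm_inj) | exact: (IHw (nbr v i))].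
Qed.

End Relabel.

(** Cancelling two equal consecutive letters does not change the end point of a
    walk, nor, by compatibility, of its translations.  The word [r] has to serve
    all the families [sigma] at once: the constant family [1] then gives the
    end point of the walk itself. *)
Lemma reduce w : exists2 r, reduced r &
  forall sigma, compatible sigma -> forall v u,
    walk u (relabel sigma v r) = walk u (relabel sigma v w).
Proof.
elim: w => [|i w [r redr rw]]; first by exists [::].
have [redir|[r' r'E]] := reduced_cons i redr.
  by exists (i :: r) => // sigma cs v u /=; exact: rw.
exists r' => [|sigma cs v u /=].
  by move: redr; rewrite r'E; exact: path_sorted.
by rewrite -(rw _ cs) r'E /= nbrK cs nbrK.
Qed.

Lemma reduce_walk w : exists2 r, reduced r & forall v, walk v r = walk v w.
Proof.
have [r redr rw] := reduce w; exists r => // v.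
by have := rw _ compatible1 v v; rewrite !relabel1.
Qed.

Lemma reduced_ex v u : exists w, reduced w /\ walk v w = u.
Proof.
have [w <-] := walk_ex v u; have [r redr rw] := reduce_walk w.
by exists r; rewrite rw.
Qed.

Lemma relabel_closed sigma v u w : compatible sigma ->
  walk v w = v -> walk u (relabel sigma v w) = u.
Proof.
move=> cs wv; have [r redr rw] := reduce w.
have rv : walk v r = v.
  by have := rw _ compatible1 v v; rewrite !relabel1 wv.
by rewrite -rw // (closed_reduced_nil redr rv).
Qed.

(** One walk followed by the reverse of the other is closed, hence so is its
    translation, which compatibility makes the first translated walk followed by
    the reverse of the second.  This makes the automorphism below well
    defined. *)
Lemma relabel_end sigma v u w w' : compatible sigma ->
  walk v w = walk v w' ->
  walk u (relabel sigma v w) = walk u (relabel sigma v w').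
Proof.
move=> cs ww'.
have cl : walk v (w ++ rev w') = v by rewrite walk_cat ww' walk_rev.
have := relabel_closed u cs cl.
rewrite relabel_cat ww' relabel_rev // walk_cat => E.
by rewrite -{2}E -{2}[relabel sigma v w']revK walk_rev.
Qed.

(** The image of a vertex is obtained by translating any word that leads to it
    from [x].  Injectivity holds because translation preserves reduced words,
    which never return to their starting point; surjectivity because the image
    is stable under taking neighbours. *)
Lemma aut_of_local_action sigma x y : compatible sigma ->
  exists g : tree_aut T, g x = y /\ forall v, local_action l g v = sigma v.
Proof.
move=> cs; have [wd wdP] := choice (walk_ex x).
pose f v := walk y (relabel sigma x (wd v)).
have fE w : f (walk x w) = walk y (relabel sigma x w).
  exact: relabel_end (wdP _).
have fn v i : f (nbr v i) = nbr (f v) (sigma v i).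
  rewrite -{1}(wdP v) -walk_rcons fE -cats1 relabel_cat walk_cat /=.
  by rewrite wdP.
have fx : f x = y by rewrite -{1}[x]/(walk x [::]) fE.
have fw v w : f (walk v w) = walk (f v) (relabel sigma v w).
  by elim: w v => //= i w IHw v; rewrite IHw fn.
have finj : injective f.
  move=> v u; have [w [redw <-]] := reduced_ex v u.
  rewrite fw => /esym/(closed_reduced_nil (reduced_relabel cs _ redw)).
  by case: w {redw}.
have fnV v j : nbr (f v) j = f (nbr v ((sigma v)^-1%g j)).
  by rewrite fn permKV.
have fsurj u : exists v, f v = u.
  have [w <-] := walk_ex y u; rewrite -fx.
  elim/last_ind: w => [|w j [v vE]]; first by exists x.
  by rewrite walk_rcons -vE fnV; eexists.
have fbij : bijective f.
  rewrite -setTT_bijective; split=> // [u v _ _|u _]; first exact: finj.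
  by have [v <-] := fsurj u; exists v.
have fadj v u : adj T (f v) (f u) = adj T v u.
  apply/idP/idP => [/adj_ex_nbr[j]|/adj_ex_nbr[i ->]].
    by rewrite fnV => /finj->; exact: adj_nbr.
  by rewrite fn adj_nbr.
exists (Defs.Aut fbij fadj); split=> // v.
by apply: local_action_nbr => i; exact: fn.
Qed.

(** * Reduced words as addresses *)

Definition address x v : seq 'I_d := sval (cid (reduced_ex x v)).

Lemma reduced_address x v : reduced (address x v).
Proof. exact: (svalP (cid (reduced_ex x v))).1. Qed.

Lemma walk_address x v : walk x (address x v) = v.
Proof. exact: (svalP (cid (reduced_ex x v))).2. Qed.

Lemma address_walk x w : reduced w -> address x (walk x w) = w.
Proof.
move=> redw; apply: (reduced_inj (reduced_address _ _) redw).
exact: walk_address.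
Qed.

Lemma reduced_rcons2 w j i :
  reduced (rcons (rcons w j) i) = reduced (rcons w j) && (j != i).
Proof. by case: w => [|k w]; rewrite /reduced /= ?andbT // rcons_path last_rcons. Qed.

(** Moving along an edge either appends a letter to the address or deletes the
    last one, and in both cases that letter is the label of the edge. *)
Lemma address_nbr x v i :
  address x (nbr v i) = rcons (address x v) i \/
  address x v = rcons (address x (nbr v i)) i.
Proof.
move: (reduced_address x v) (walk_address x v); move: (address x v) => w + <-.
case/lastP: w => [|w j] redw.
  by left; exact: (address_walk x (w := [:: i])).
have [<-|ji] := eqVneq j i.
  right; rewrite walk_rcons nbrK address_walk //.
  exact: prefix_sorted (prefix_rcons _ _) redw.
by left; rewrite -walk_rcons address_walk // reduced_rcons2 redw.
Qed.

Lemma reduced_word_ex i n : 1 < d -> exists2 w, reduced (rcons w i) & size w = n.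
Proof.
move=> d1; elim: n i => [|n IHn] i; first by exists [::].
have : ~~ [forall j, j == i].
  apply: contraL d1 => /forallP ji; rewrite -leqNgt -[d]card_ord.
  by apply/fintype_le1P => j k; rewrite (eqP (ji j)) (eqP (ji k)).
case/forallPn=> j ji; have [w redw sw] := IHn j.
by exists (rcons w j); rewrite ?size_rcons ?sw // reduced_rcons2 redw.
Qed.

End Words.

(** * The action of the universal group *)

Section UniversalGroup.
Context {d : nat} {T : regular_tree d} (l : legal_labelling T).
Context (F : {group 'S_d}).
Implicit Types (v u x y : T) (i j : 'I_d) (w r : seq 'I_d) (g h : tree_aut T).

Lemma universal_groupP g :
  reflect (forall v, local_action l g v \in F) (g \in universal_group l F).
Proof. exact: asboolP. Qed.

Lemma universal_constant x y (s : 'S_d) : s \in F ->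
  exists g, [/\ g \in universal_group l F, g x = y &
    forall v, local_action l g v = s].
Proof.
move=> sF; have [//|g [gx gs]] := @aut_of_local_action _ _ l (fun=> s) x y.
by exists g; split=> //; apply/universal_groupP => v; rewrite gs.
Qed.

Lemma universal_vertex_transitive : vertex_transitive (universal_group l F).
Proof.
move=> x y; have [g [gU gx _]] := universal_constant x y (group1 F).
by exists g.
Qed.

(** The labelling of the star of [x] carries the permutation induced by [g] to
    the local action of [g] at [x]; constant families reach all of [F]. *)
Lemma universal_locally_isomorphic :
  locally_perm_isomorphic (universal_group l F) F.
Proof.
move=> x; pose phi : star x -> 'I_d := @local_label d T l x.
pose psi : 'I_d -> star x := local_label_inv l x.
have phiK : cancel phi psi by exact: bij_invK.
have psiK : cancel psi phi by exact: bij_invKV.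
exists phi, (fun p => phi \o p \o psi).
have phiE g p : g x = x -> (forall e, val (p e) = aut_edge g (val e)) ->
    phi \o p \o psi = local_action l g x.
  move=> gx pg; apply/funext => i /=.
  rewrite /phi /local_label pg -/(edge_at l x i) aut_edge_at.
  exact: label_edge_at.
split.
- exact: (label_bij l x).
- split.
  + move=> p [g [/universal_groupP gU gx pg]].
    by exists (local_action l g x); [exact: gU | rewrite (phiE g)].
  + move=> p q _ _ pq; apply/funext => e.
    by apply: (can_inj phiK); rewrite -(phiK e); exact: (congr1 (@^~ (phi e)) pq).
  + move=> _ [s sF <-]; have [g [gU gx gs]] := universal_constant x x sF.
    exists (psi \o s \o phi); last by apply/funext => i /=; rewrite !psiK.
    exists g; split=> // e /=.
    rewrite -[e]phiK psiK -[val (psi _)]/(edge_at l x _).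
    rewrite -[X in aut_edge g X]/(edge_at l x (phi e)) aut_edge_at gs gx.
    by [].
- by move=> p q _ _; apply/funext => i /=; rewrite phiK.
- by move=> p _ e /=; rewrite phiK.
Qed.

Lemma label_geom_edge (e f : edge T) : geom_edge e f -> l f = l e.
Proof. by case=> ->; rewrite ?label_rev. Qed.

(** The two orientations of an edge have the same label, so mapping one
    geometric edge onto another forces the local action to map the label of the first to
    that of the second, whatever the orientation of the image. *)
Lemma universal_edge_transitive : 0 < d ->
  edge_transitive (universal_group l F) <->
    [transitive F, on [set: 'I_d]%SET | 'P].
Proof.
move=> d0; split=> [et|tr e f].
  pose i := Ordinal d0.
  apply/imsetP; exists i => //.
  apply/setP => j; rewrite inE; apply/esym/orbitP.
  have [x] := tree_nonempty T.
  have [g /universal_groupP gU gef] := et (edge_at l x i) (edge_at l x j).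
  have : geom_edge (edge_at l x j) (aut_edge g (edge_at l x i)).
    by rewrite -gef; eexists; [left|].
  move/label_geom_edge; rewrite aut_edge_at !label_edge_at => gij.
  by exists (local_action l g x); [exact: gU|exact: gij].
have [s sF /= sef] : exists2 s, s \in F & l f = 'P%act (l e) s.
  by apply: (atransP2 tr); rewrite inE.
have [g [gU ge gs]] := universal_constant (org e) (org f) sF.
exists g => //; have gef : aut_edge g e = f.
  by rewrite -{1}(edge_atE l e) aut_edge_at ge gs -[s _]/(aperm _ s) -sef edge_atE.
rewrite /geom_edge image_setU !image_set1 gef.
by congr (_ `|` [set _])%classic; apply: val_inj; rewrite -gef.
Qed.

(** Fixing an edge propagates: the local action at [v] fixes a label, hence is
    trivial, hence every neighbour of [v] is fixed together with its edge
    to [v]. *)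
Lemma free_fixes_all : free_action F -> forall g v i,
  g \in universal_group l F -> g v = v -> g (nbr l v i) = nbr l v i -> g = 1%g.
Proof.
move=> free g v i /universal_groupP gU gv gvi.
suff fixw w : g (walk l v w) = walk l v w.
  by apply: aut_ext => u; have [w <-] := walk_ex l v u; rewrite fixw.
elim: w v i gv gvi => //= j w IHw v i gv gvi.
have s1 : local_action l g v = 1%g.
  apply/eqP/negPn/negP => /(free _ (gU v)) /(_ i) /eqP; apply.
  by have := aut_nbr l g v i; rewrite gvi gv => /nbr_inj.
have gvj : g (nbr l v j) = nbr l v j by rewrite (aut_nbr l) s1 perm1 gv.
by apply: (IHw _ j) => //; rewrite nbrK.
Qed.

(** The local action is [s] at the vertices whose address from [x] has [i] as its
    letter of index [n], and trivial elsewhere.  The region where it is [s] is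
    entered through edges labelled [i] only, and [s] fixes [i], so the family is
    compatible. *)
Lemma twist_outside_ball x (n : nat) (s : 'S_d) i : 1 < d ->
  s \in F -> s != 1%g -> s i = i ->
  exists g, [/\ g \in universal_group l F, g != 1%g &
    forall w, reduced w -> size w <= n -> g (walk l x w) = walk l x w].
Proof.
move=> d1 sF s1 si.
pose sigma v := if onth (address l x v) n == Some i then s else 1%g.
have step v j : address l x (nbr l v j) = rcons (address l x v) j ->
    sigma (nbr l v j) j = sigma v j.
  move=> a; rewrite /sigma a -cats1 onth_cat.
  case: ltngtP => [//|lt|nE].
    by rewrite !onth_default //= ?subn_gt0 // ltnW.
  have -> : onth (address l x v) n = None by rewrite onth_default ?nE.
  rewrite nE subnn /=.
  by case: eqP => [[->]|]; rewrite ?si perm1.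
have cs : compatible l sigma.
  move=> v j; have [/step //|a] := address_nbr l x v j.
  by have := step (nbr l v j) j; rewrite nbrK => /(_ a).
have [g [gx gs]] := aut_of_local_action x x cs.
exists g; split.
- apply/universal_groupP => v; rewrite gs /sigma.
  by case: ifP => // _; exact: group1.
- apply: contraNneq s1 => g1; apply/eqP.
  have [w redw sw] := reduced_word_ex i n d1.
  rewrite -(local_action1 l (walk l x (rcons w i))) -g1 gs /sigma.
  by rewrite address_walk // -cats1 onth_cat sw ltnn subnn /= eqxx.
- elim/last_ind=> [//|w j IHw] redw; rewrite size_rcons => wn.
  have redw' := prefix_sorted (prefix_rcons _ _) redw.
  rewrite walk_rcons (aut_nbr l) IHw //; last exact: ltnW.
  by rewrite gs /sigma address_walk // onth_default ?perm1 // ltnW.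
Qed.

End UniversalGroup.

(** * Pointwise convergence *)

Section Topology.
Context {d : nat} {T : regular_tree d}.
Local Open Scope classical_set_scope.

Lemma open_eval (v u : T) : open [set g : tree_aut T | g v = u].
Proof.
exists ([set f : {ptws T -> discrete_topology T} | f v = u]) => //.
rewrite openE => f fv; rewrite /interior.
have /cvg_sup/(_ v) : nbhs f --> f by exact: cvg_id.
apply; exists [set f : T -> discrete_topology T | f v = u]; split=> //.
by exists [set u] => //; exact: discrete_open.
Qed.

Lemma near_eval (g : tree_aut T) (v : T) :
  nbhs g [set h : tree_aut T | h v = g v].
Proof. by apply: open_nbhs_nbhs; split=> //; exact: open_eval. Qed.

Lemma pointwise_cvg_aut (g_ : nat -> tree_aut T) (g : tree_aut T) :
  (forall v, \forall n \near \oo, g_ n v = g v) -> g_ @ \oo --> g.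
Proof.
move=> cv A; rewrite nbhsE => -[B [[C oC <-] Cg] BA].
have fcv : cvg_to (fmap (fun n => aut_fun (g_ n)) \oo)
    (nbhs (aut_fun g : {ptws T -> discrete_topology T})).
  apply/cvg_sup => v D.
  rewrite nbhsE => -[E [[S oS <-] Sg] SD].
  move: (cv v); apply: filterS => n gn; apply: SD => /=.
  by rewrite gn.
have fC : nbhs \oo [set n | C (aut_fun (g_ n))].
  by apply: fcv; exact: open_nbhs_nbhs.
by apply: filterS fC => n Cn; exact: BA.
Qed.

End Topology.

(** * Closedness and discreteness *)

Section UniversalTopology.
Context {d : nat} {T : regular_tree d} (l : legal_labelling T).
Context (F : {group 'S_d}).
Local Open Scope classical_set_scope.
Let U : set (tree_aut T) := [set` universal_group l F].

(** The local action at [v] is determined by finitely many values. *)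
Lemma near_local_action (g : tree_aut T) (v : T) :
  nbhs g [set h : tree_aut T | local_action l h v = local_action l g v].
Proof.
have near_star :
    nbhs g [set h : tree_aut T | forall i, h (nbr l v i) = g (nbr l v i)].
  pose agree i (h : tree_aut T) := h (nbr l v i) = g (nbr l v i).
  apply: (@filter_forall _ _ agree (nbhs g) (nbhs_filter g)) => i.
  exact: near_eval.
apply: filterS2 (near_eval g v) near_star => h hv hvi.
by apply: local_action_nbr => i; rewrite hvi hv (aut_nbr l).
Qed.

Lemma universal_closed : closed U.
Proof.
move=> g gU; apply/universal_groupP => v.
have [h [/universal_groupP/(_ v) + <-]] := gU _ (near_local_action g v).
exact.
Qed.

(** Without freeness, the elements fixing larger and larger balls converge to the
    identity but differ from it, so that the identity is not isolated.  With
    freeness, the elements of the group are told apart by their values at the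
    two ends of a single edge. *)
Lemma universal_discrete : 1 < d -> discrete_subset U <-> free_action F.
Proof.
move=> d1; have [x] := tree_nonempty T; split=> [disc s sF s1 i|free B].
  apply/negP => /eqP si.
  have [g_ gP] := choice (fun n => twist_outside_ball l x n d1 sF s1 si).
  have U1 : U 1%g by exact: universal_group1.
  pose e : set_type U := exist (fun h => h \in U) 1%g (mem_set U1).
  have [V oV VE] := disc [set e].
  have V1 : V 1%g by have : [set e] e by []; rewrite -VE.
  have VU h : V h -> U h -> h = 1%g.
    move=> Vh Uh; pose k : set_type U := exist (fun h => h \in U) h (mem_set Uh).
    have : [set e] k by rewrite -VE.
    by move/(congr1 val).
  have gcv : g_ @ \oo --> (1%g : tree_aut T).
    apply: pointwise_cvg_aut => v.
    have [w [redw <-]] := reduced_ex l x v.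
    exists (size w) => // n /= wn.
    by have [_ _ ->] := gP n.
  have : nbhs (1%g : tree_aut T) V.
    exact: open_nbhs_nbhs.
  move/gcv => [n _ /(_ n (leqnn n)) Vn].
  have [gU /eqP g1 _] := gP n.
  exact: g1 (VU _ Vn gU).
pose i : 'I_d := Ordinal (ltnW d1).
pose y := nbr l x i.
(* The open set that cuts out B: whatever agrees with a member of B on the
   edge from x to y. *)
exists [set h : tree_aut T | exists2 b, B b & h x = val b x /\ h y = val b y].
  rewrite openE => h [b Bb [hx hy]]; rewrite /interior.
  apply: filterS2 (near_eval h x) (near_eval h y) => k kx ky.
  by exists b; rewrite ?kx ?ky.
apply/seteqP; split=> [[h hU] [[b bU] Bb /= [hx hy]]|b Bb]; last by exists b.
suff hb : h = b by subst b; rewrite (Prop_irrelevance hU bU).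
have bhU : (b^-1 * h)%g \in universal_group l F.
  by apply: universal_groupM; [apply: universal_groupV; exact: set_mem bU
                              | exact: set_mem hU].
have fixb z : h z = b z -> (b^-1 * h)%g z = z.
  by move=> hz; rewrite /= hz; exact: bij_invK.
have := free_fixes_all free bhU (fixb _ hx) (fixb _ hy).
by move/(congr1 (mulg b)); rewrite mulKVg mulg1.
Qed.

End UniversalTopology.

Theorem proposition4p6 (d : nat) (T : regular_tree d) (l : legal_labelling T)
    (F : {group 'S_d}) (hd : 3 <= d) :
  [/\ closed [set` universal_group l F]%classic,
      locally_perm_isomorphic (universal_group l F) F,
      vertex_transitive (universal_group l F),
      edge_transitive (universal_group l F) <->
        [transitive F, on [set: 'I_d]%SET | 'P] &
      discrete_subset [set` universal_group l F]%classic <-> free_action F].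
Proof.
split.
- exact: universal_closed.
- exact: universal_locally_isomorphic.
- exact: universal_vertex_transitive.
- exact: universal_edge_transitive (ltnW (ltnW hd)).
- exact: universal_discrete (ltnW hd).
Qed.
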